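(* Let $0<\beta<1$ and $\alpha\ge1$ be constants. Let $I$ be an instance of a minimization problem, and let an $\alpha$-approximate present-biased agent that makes no inconsistent choices construct the solution $S=\{x_0,\dots,x_k\}$ for $I$. Then $$c(S)\le\frac{\alpha}{\beta}\,\mathrm{opt}(I).$$ This holds independently of whether the agent makes superfluous choices or not (that is, the intermediate feasible solutions computed by the agent need not be inclusion-minimal).
   Context: **Minimization problems.** An instance $I$ consists of a finite nonempty ground set $\mathcal S_I$, a weight function $\omega:\mathcal S_I\to\mathbb N$ (where $\mathbb N=\{1,2,\dots\}$), and a family $F(I)$ of subsets of $\mathcal S_I$, called feasible solutions, that contains $\mathcal S_I$ and is closed upward: $S\in F(I)$ and $S\subseteq S'\subseteq\mathcal S_I$ imply $S'\in F(I)$. The cost of $S$ is $c(S)=\sum_{x\in S}\omega(x)$, and $\mathrm{opt}(I)=\min_{S\in F(I)}c(S)$. For $x\in\mathcal S_I$, $I\smallsetminus\{x\}$ is the instance with ground set $\mathcal S_I\smallsetminus\{x\}$, the same weights, and feasible solutions $S\smallsetminus\{x\}$ for $S\in F(I)$. A minimization problem is a class of such instances closed under $I\mapsto I\smallsetminus\{x\}$. The initial instance $I$ is assumed to satisfy $\emptyset\notin F(I)$. **Biased cost.** For nonempty $S$, $c_\beta(S)=\omega(x)+\beta\,c(S\smallsetminus\{x\})$, where $x\in\operatorname{argmin}_{y\in S}\omega(y)$. **$\alpha$-approximate present-biased agent.** Put $I_0=I$. At step $i\ge0$, the agent computes some feasible solution $S_i$ of $I_i$ with $c_\beta(S_i)\le\alpha\min_{S\in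 F(I_i)}c_\beta(S)$ and selects some $x_i\in\operatorname{argmin}_{y\in S_i}\omega(y)$. It stops as soon as $\{x_0,\dots,x_i\}\in F(I)$; otherwise it continues with $I_{i+1}=I_i\smallsetminus\{x_i\}$. **Inconsistent choices.** An element $x$ is inconsistent with a feasible solution $S$ if $x\notin S$. The agent makes no inconsistent choices if every chosen element is consistent with all feasible solutions used before, that is, $x_i\in S_j$ for all $0\le j\le i\le k$. **Superfluous choices.** An element $x\in S$ is superfluous in a feasible solution $S$ if $S\smallsetminus\{x\}$ is also feasible for the same instance. *)

(* Defs.v *)
From HB Require Import structures.
From mathcomp Require Import all_boot all_order all_algebra.

Set Implicit Arguments.
Unset Strict Implicit.
Unset Printing Implicit Defensive.

Import Order.TTheory GRing.Theory Num.Theory.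
Local Open Scope ring_scope.

(* The ground set is a subset of an ambient finite type, so that deleting an  *)
(* element does not change the type. Values of [weight] outside [ground] are  *)
(* irrelevant.                                                                *)
Record instance_data (T : finType) := InstanceData {
  ground : {set T};
  weight : T -> nat;
  feasible : {set {set T}}
}.

Record is_instance (T : finType) (I : instance_data T) : Prop := IsInstance {
  ground_neq0 : ground I != set0;
  weight_gt0 : forall x, x \in ground I -> (0 < weight I x)%N;
  feasible_sub : forall S, S \in feasible I -> S \subset ground I;
  ground_feasible : ground I \in feasible I;
  feasible_up : forall S S' : {set T},
    S \in feasible I -> S \subset S' -> S' \subset ground I ->
    S' \in feasible I
}.

Definition delete (T : finType) (I : instance_data T) (x : T) :=
  InstanceData (ground I :\ x) (weight I) [set S :\ x | S in feasible I].

(* Deleting the only element of a ground set does not leave an instance, so   *)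
(* closure under deletion is required whenever the new ground set is nonempty.*)
Record minimization_problem := MinimizationProblem {
  instance_of :> forall T : finType, instance_data T -> Prop;
  instance_ofP : forall (T : finType) (I : instance_data T),
    instance_of I -> is_instance I;
  instance_of_delete : forall (T : finType) (I : instance_data T) (x : T),
    instance_of I -> x \in ground I -> ground I :\ x != set0 ->
    instance_of (delete I x)
}.

Section Costs.
Variables (T : finType) (I : instance_data T).

Definition cost (S : {set T}) : nat := (\sum_(x in S) weight I x)%N.

(* The default [ground I] of the argmin is feasible in every instance.        *)
Definition opt : nat :=
  cost [arg min_(S < ground I | S \in feasible I) cost S]%N.

Definition cheapest (S : {set T}) : {set T} :=
  [set x in S | [forall y in S, (weight I x <= weight I y)%N]].

(* By [biased_costE] the value does not depend on the picked element; it is   *)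
(* 0 by convention when S is empty.                                           *)
Definition biased_cost (R : realFieldType) (beta : R) (S : {set T}) : R :=
  if [pick x in cheapest S] is Some x
  then (weight I x)%:R + beta * (cost (S :\ x))%:R else 0.

Definition min_biased_cost (R : realFieldType) (beta : R) : R :=
  biased_cost beta
    [arg min_(S < ground I | S \in feasible I) biased_cost beta S]%O.

End Costs.

Section Agent.
Variables (T : finType) (I : instance_data T).

Fixpoint residual (x : nat -> T) (i : nat) : instance_data T :=
  if i is j.+1 then delete (residual x j) (x j) else I.

(* The first n choices x_0, ..., x_(n-1).                                     *)
Definition chosen (x : nat -> T) (n : nat) : {set T} :=
  [set x (val j) | j : 'I_n].

(* A run with choices x_0, ..., x_k and intermediate feasible solutions       *)
(* S_0, ..., S_k; the values of x and S beyond k are irrelevant.              *)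
Record present_biased_run (R : realFieldType) (alpha beta : R) (k : nat)
    (x : nat -> T) (S : nat -> {set T}) : Prop := PresentBiasedRun {
  run_feasible : forall i, (i <= k)%N -> S i \in feasible (residual x i);
  run_approx : forall i, (i <= k)%N ->
    biased_cost (residual x i) beta (S i)
      <= alpha * min_biased_cost (residual x i) beta;
  run_choice : forall i, (i <= k)%N -> x i \in cheapest (residual x i) (S i);
  run_continue : forall i, (i < k)%N -> chosen x i.+1 \notin feasible I;
  run_stop : chosen x k.+1 \in feasible I
}.

Definition no_inconsistent_choices (k : nat) (x : nat -> T)
    (S : nat -> {set T}) : Prop :=
  forall i j, (j <= i <= k)%N -> x i \in S j.

End Agent.

Lemma biased_costE (T : finType) (I : instance_data T) (R : realFieldType)
    (beta : R) (S : {set T}) (x : T) :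
  x \in cheapest I S ->
  biased_cost I beta S = (weight I x)%:R + beta * (cost I (S :\ x))%:R.
Proof.
move=> xS; rewrite /biased_cost; case: pickP => [y yS|/(_ x)]; last by rewrite xS.
move: xS yS; rewrite !inE => /andP[xS /forall_inP xmin] /andP[yS /forall_inP ymin].
have wE : weight I y = weight I x by apply/eqP; rewrite eqn_leq ymin ?xmin.
have cE z : z \in S -> cost I S = (weight I z + cost I (S :\ z))%N.
  exact: big_setD1.
congr (_%:R + beta * _%:R) => //; apply: (@addnI (weight I x)).
by rewrite -cE // -wE -cE.
Qed.

Lemma delete_is_instance (T : finType) (I : instance_data T) (x : T) :
  is_instance I -> ground I :\ x != set0 -> is_instance (delete I x).
Proof.
move=> [_ w0 fs gf fup] n0; split=> //=.
- by move=> y; rewrite !inE => /andP[_ /w0].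
- by move=> _ /imsetP[S /fs SI ->]; apply: setSD.
- exact: imset_f.
- move=> _ S' /imsetP[S SF ->] SS' S'g.
  have xS' : x \notin S'.
    by apply/negP => /(subsetP S'g); rewrite !inE eqxx.
  have S'I : S' \subset ground I := subset_trans S'g (subsetDl _ _).
  have [xS|xS] := boolP (x \in S).
    apply/imsetP; exists (x |: S'); last by rewrite setU1K.
    apply: (fup S) => //; first by rewrite -subDset.
    by rewrite subUset S'I andbT sub1set (subsetP (fs _ SF)).
  have Sx (A : {set T}) : x \notin A -> A :\ x = A.
    by move=> xA; apply/setDidPl; rewrite disjoint_sym disjoints1.
  apply/imsetP; exists S'; last by rewrite Sx.
  by apply: (fup S) => //; rewrite -(Sx S).
Qed.

(* Main.v *)
Require Import Defs.
From mathcomp Require Import all_boot all_order all_algebra.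

Set Implicit Arguments.
Unset Strict Implicit.
Unset Printing Implicit Defensive.

Import Order.TTheory GRing.Theory Num.Theory.
Local Open Scope ring_scope.

(** Consistency with the first solution S_0 puts every choice in S_0, so the
    constructed solution S costs at most c(S_0). Since
    beta * c <= c_beta <= c, the first approximation guarantee alone yields
    beta * c(S_0) <= c_beta(S_0) <= alpha * c_beta(OPT) <= alpha * opt. *)

Lemma cost_setD1 (T : finType) (I : instance_data T) (S : {set T}) (x : T) :
  x \in S -> cost I S = (weight I x + cost I (S :\ x))%N.
Proof. exact: big_setD1. Qed.

Lemma cost_subset (T : finType) (I : instance_data T) (A B : {set T}) :
  A \subset B -> (cost I A <= cost I B)%N.
Proof.
by move=> /setIidPr AB; rewrite /cost [leqRHS](big_setID A) AB leq_addr.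
Qed.

Lemma cheapest_sub (T : finType) (I : instance_data T) (S : {set T}) :
  cheapest I S \subset S.
Proof. by apply/subsetP => x; rewrite inE => /andP[]. Qed.

(** Discounting by [beta <= 1] can only shrink the part of the cost beyond one cheapest element. For
    empty [S] the conventional value 0 is enough. *)
Lemma biased_cost_le (T : finType) (I : instance_data T) (R : realFieldType)
    (beta : R) (S : {set T}) :
  beta <= 1 -> biased_cost I beta S <= (cost I S)%:R.
Proof.
move=> beta1; rewrite /biased_cost; case: pickP => [y yS|_]; last exact: ler0n.
rewrite (cost_setD1 _ (subsetP (cheapest_sub _ _) _ yS)) natrD lerD2l.
exact: ler_piMl.
Qed.

(** The two sides differ only in the weight of the cheapest element, which the left side discounts
    as well. *)
Lemma le_biased_cost (T : finType) (I : instance_data T) (R : realFieldType)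
    (beta : R) (S : {set T}) (x : T) :
  beta <= 1 -> x \in cheapest I S ->
  beta * (cost I S)%:R <= biased_cost I beta S.
Proof.
move=> beta1 xS; rewrite (biased_costE _ xS).
rewrite (cost_setD1 _ (subsetP (cheapest_sub _ _) _ xS)) natrD mulrDr lerD2r.
exact: ler_piMl.
Qed.

(** A solution of minimum cost need not minimize the biased cost, but it competes in that minimum.
    [gF] makes the default of both minima feasible. *)
Lemma min_biased_cost_le_opt (T : finType) (I : instance_data T)
    (R : realFieldType) (beta : R) :
  ground I \in feasible I -> beta <= 1 ->
  min_biased_cost I beta <= (opt I)%:R.
Proof.
move=> gF beta1; rewrite /opt; case: arg_minnP => // S SF _.
rewrite /min_biased_cost; case: Order.TotalTheory.arg_minP => // S' _ minS'.
exact: le_trans (minS' _ SF) (biased_cost_le _ _ beta1).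
Qed.

Theorem theorem3 (R : realFieldType) (alpha beta : R)
  (hbeta0 : 0 < beta) (hbeta1 : beta < 1) (halpha : 1 <= alpha)
  (P : minimization_problem) (T : finType) (I : instance_data T)
  (hI : P T I) (hI0 : set0 \notin feasible I)
  (k : nat) (x : nat -> T) (S : nat -> {set T})
  (hrun : present_biased_run I alpha beta k x S)
  (hcons : no_inconsistent_choices k x S) :
  (cost I (chosen x k.+1))%:R <= alpha / beta * (opt I)%:R.
Proof.
have gF := ground_feasible (instance_ofP hI).
have chosen_sub : chosen x k.+1 \subset S 0%N.
  (* Consistency is used at [j = 0] only; [i < k.+1] computes to [0 <= i <= k]. *)
  by apply/subsetP => _ /imsetP[i _ ->]; exact: (hcons i 0%N (ltn_ord i)).
rewrite mulrAC ler_pdivlMr // mulrC.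
apply: (@le_trans _ _ (beta * (cost I (S 0%N))%:R)).
  by rewrite ler_pM2l // ler_nat cost_subset.
(* [residual x 0] reduces to [I], so the conditions on the run at step 0 concern the original
   instance and its optimum. *)
apply: le_trans (le_biased_cost (ltW hbeta1) (run_choice hrun (leq0n k))) _.
apply: le_trans (run_approx hrun (leq0n k)) _.
apply: ler_wpM2l; first exact: le_trans ler01 halpha.
exact: min_biased_cost_le_opt gF (ltW hbeta1).
Qed.
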